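(* Let $q_1,\dots,q_n$ be the position variables, let $$u=-\sum_{i\neq j}\coth(q_i-q_j)\,E_{ij}\otimes E_{ji},\qquad s=\sum_{i\neq j}\frac{1}{\sinh(q_i-q_j)}\,E_{ij}\otimes E_{jj},\qquad w=\sum_{i\neq j}\coth(q_i-q_j)\,E_{ii}\otimes E_{jj},$$ and let the $r$-matrix of the (hyperbolic) Ruijsenaars--Schneider model be given by $$a=-u-s+s^\pi+w-\mathcal C,\qquad b=-s^\pi-w,\qquad c=-s+w,\qquad d=-u-w-\mathcal C.$$ Then $a,b,c,d$ satisfy $$[a_{12},a_{13}]+[a_{12},a_{23}]+[a_{13},a_{23}]=0,$$ $$[d_{12},d_{13}]+[d_{12},d_{23}]+[d_{13},d_{23}]+\sum_k h^{(1)}_k\partial_k d_{23}-\sum_k h^{(2)}_k\partial_k d_{13}+\sum_k h^{(3)}_k\partial_k d_{12}=0,$$ $$[d_{12},b_{13}]+[d_{12},b_{23}]+[b_{13},b_{23}]+\sum_k h^{(1)}_k\partial_k b_{23}-\sum_k h^{(2)}_k\partial_k b_{13}=0,$$ $$[a_{12},c_{13}]+[a_{12},c_{23}]+[c_{13},c_{23}]-\sum_k h^{(3)}_k\partial_k a_{12}=0.$$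
   Context: $E_{ij}$ are the elementary $n\times n$ matrices acting on $V=\mathbb C^n$; $\pi$ denotes the permutation of the two tensor factors in $\mathrm{End}(V\otimes V)$; $\mathcal C=\sum_{i,j}E_{ij}\otimes E_{ji}$ is the Casimir operator. Indices $1,2,3$ label the copies of $V$ in $V\otimes V\otimes V$ on which matrices act; $\partial_k=\partial/\partial q_k$; $h_k^{(i)}$ denotes $h_k=E_{kk}$ acting in the $i$-th copy. The $q_i$ are such that all the functions above are defined ($q_i\ne q_j$, etc.). *)

(* Defs.v *)
From HB Require Import structures.
From mathcomp Require Import all_boot all_order all_algebra.
From mathcomp Require Import complex mxtens.
From mathcomp Require Import all_classical all_reals all_analysis.

Set Implicit Arguments.
Unset Strict Implicit.
Unset Printing Implicit Defensive.

Import Order.TTheory GRing.Theory Num.Theory.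
Import numFieldNormedType.Exports.

Local Open Scope ring_scope.

Notation "A *t B" := (tensmx A B)
  (at level 40, left associativity, format "A  *t  B") : ring_scope.

Section ComplexHyperbolic.
Variable R : realType.
Implicit Type z : R[i].

Definition expc z : R[i] :=
  Complex (expR (complex.Re z) * cos (complex.Im z))
          (expR (complex.Re z) * sin (complex.Im z)).

Definition sinhc z : R[i] := (expc z - expc (- z)) / 2.
Definition coshc z : R[i] := (expc z + expc (- z)) / 2.
Definition cothc z : R[i] := coshc z / sinhc z.

End ComplexHyperbolic.

(* For K the complex numbers: V = K^n, End(V) = 'M_n,
   End(V (x) V) = 'M_(n * n) and End(V (x) V (x) V) = 'M_(n * n * n), where (x)
   is the Kronecker product *t, associated to the left. *)
Section TensorLegs.
Variables (K : comNzRingType) (n : nat).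
Implicit Types (A B : 'M[K]_n) (X Y : 'M[K]_(n * n)).

Definition lie m (S T : 'M[K]_m) : 'M[K]_m := S *m T - T *m S.

Definition swap_index (r : 'I_(n * n)) : 'I_(n * n) :=
  mxtens_index ((mxtens_unindex r).2, (mxtens_unindex r).1).

Definition flip X : 'M[K]_(n * n) :=
  \matrix_(r, c) X (swap_index r) (swap_index c).

Definition site1 (r : 'I_(n * n * n)) : 'I_n :=
  (mxtens_unindex (mxtens_unindex r).1).1.
Definition site2 (r : 'I_(n * n * n)) : 'I_n :=
  (mxtens_unindex (mxtens_unindex r).1).2.
Definition site3 (r : 'I_(n * n * n)) : 'I_n := (mxtens_unindex r).2.

Definition leg12 X : 'M[K]_(n * n * n) :=
  \matrix_(r, c) (X (mxtens_index (site1 r, site2 r))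
                    (mxtens_index (site1 c, site2 c))
                  * (site3 r == site3 c)%:R).
Definition leg13 X : 'M[K]_(n * n * n) :=
  \matrix_(r, c) (X (mxtens_index (site1 r, site3 r))
                    (mxtens_index (site1 c, site3 c))
                  * (site2 r == site2 c)%:R).
Definition leg23 X : 'M[K]_(n * n * n) :=
  \matrix_(r, c) (X (mxtens_index (site2 r, site3 r))
                    (mxtens_index (site2 c, site3 c))
                  * (site1 r == site1 c)%:R).

Definition h1 (k : 'I_n) : 'M[K]_(n * n * n) :=
  (delta_mx k k : 'M[K]_n) *t (1%:M : 'M[K]_n) *t (1%:M : 'M[K]_n).
Definition h2 (k : 'I_n) : 'M[K]_(n * n * n) :=
  (1%:M : 'M[K]_n) *t (delta_mx k k : 'M[K]_n) *t (1%:M : 'M[K]_n).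
Definition h3 (k : 'I_n) : 'M[K]_(n * n * n) :=
  (1%:M : 'M[K]_n) *t (1%:M : 'M[K]_n) *t (delta_mx k k : 'M[K]_n).

(* flip and the leg maps are linear, hence determined by their values on pure
   tensors. *)
Lemma flip_tens A B : flip (A *t B) = B *t A.
Proof.
by apply/matrixP => r c; rewrite !mxE !mxtens_indexK mulrC.
Qed.

Lemma leg12_tens A B : leg12 (A *t B) = A *t B *t 1%:M.
Proof. by apply/matrixP => r c; rewrite !mxE !mxtens_indexK. Qed.

Lemma leg13_tens A B : leg13 (A *t B) = A *t 1%:M *t B.
Proof.
by apply/matrixP => r c; rewrite !mxE !mxtens_indexK mulrAC.
Qed.

Lemma leg23_tens A B : leg23 (A *t B) = 1%:M *t A *t B.
Proof.
by apply/matrixP => r c; rewrite !mxE !mxtens_indexK mulrC mulrA.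
Qed.

End TensorLegs.

Section RMatrix.
Variables (R : realType) (n : nat).
Implicit Types (q : 'rV[R[i]]_n) (i j k : 'I_n).

Definition elem i j : 'M[R[i]]_n := delta_mx i j.

Definition casimir : 'M[R[i]]_(n * n) := \sum_i \sum_j elem i j *t elem j i.

Definition umx q : 'M[R[i]]_(n * n) :=
  - (\sum_i \sum_(j | i != j)
       cothc (q 0 i - q 0 j) *: (elem i j *t elem j i)).

Definition smx q : 'M[R[i]]_(n * n) :=
  \sum_i \sum_(j | i != j) (sinhc (q 0 i - q 0 j))^-1 *: (elem i j *t elem j j).

Definition wmx q : 'M[R[i]]_(n * n) :=
  \sum_i \sum_(j | i != j) cothc (q 0 i - q 0 j) *: (elem i i *t elem j j).

Definition ra q : 'M[R[i]]_(n * n) :=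
  - umx q - smx q + flip (smx q) + wmx q - casimir.
Definition rb q : 'M[R[i]]_(n * n) := - flip (smx q) - wmx q.
Definition rc q : 'M[R[i]]_(n * n) := - smx q + wmx q.
Definition rd q : 'M[R[i]]_(n * n) := - umx q - wmx q - casimir.

(* The scalar field is R[i], so this is the complex partial derivative. *)
Definition partial k (F : 'rV[R[i]]_n -> 'M[R[i]]_(n * n * n)) q :
    'M[R[i]]_(n * n * n) :=
  'D_(delta_mx 0 k) F q.

End RMatrix.

(* Main.v *)
(* In the basis of words (i,j,k), each leg of a, b, c, d sends a word to a
   combination of words in the same letters, with coefficients coth(q_i - q_j)
   and 1/sinh(q_i - q_j); the derivatives of these are again quadratic in them,
   (coth)' = - 1/sinh^2 and (1/sinh)' = - coth/sinh.  Hence every row of the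
   four identities is a combination of words with coefficients quadratic in
   coth and 1/sinh, and it vanishes, separately for each coincidence pattern of
   the row index (i,j,k), modulo
     1/sinh^2 x = coth^2 x - 1,
     coth x coth y = coth (x + y) (coth x + coth y) - 1,
     1/(sinh x sinh y) = (coth x + coth y) / sinh (x + y). *)

Require Import Defs.
From HB Require Import structures.
From mathcomp Require Import all_boot all_order all_algebra.
From mathcomp Require Import complex mxtens ring lra.
From mathcomp Require Import all_classical all_reals all_analysis.

Set Implicit Arguments.
Unset Strict Implicit.
Unset Printing Implicit Defensive.

Import Order.TTheory GRing.Theory Num.Theory.
Import numFieldNormedType.Exports.
Local Open Scope ring_scope.

Lemma addmxE (K : nmodType) m p (A B : 'M[K]_(m, p)) r c :
  (A + B) r c = A r c + B r c.
Proof. exact: mxE. Qed.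
Lemma oppmxE (K : zmodType) m p (A : 'M[K]_(m, p)) r c : (- A) r c = - A r c.
Proof. exact: mxE. Qed.

(** * Matrices acting on words *)

Section WordMatrices.
Variables (K : comNzRingType) (n : nat).
Implicit Types (D P S T : 'I_n -> 'I_n -> K) (i j k : 'I_n).

Definition idx2 i j : 'I_(n * n) := mxtens_index (i, j).
Definition idx3 i j k : 'I_(n * n * n) := mxtens_index (idx2 i j, k).

Lemma idx3P (r : 'I_(n * n * n)) : r = idx3 (site1 r) (site2 r) (site3 r).
Proof. by rewrite /idx3 /idx2 -!surjective_pairing !mxtens_unindexK. Qed.

Lemma site1K i j k : site1 (idx3 i j k) = i.
Proof. by rewrite /site1 !mxtens_indexK. Qed.
Lemma site2K i j k : site2 (idx3 i j k) = j.
Proof. by rewrite /site2 !mxtens_indexK. Qed.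
Lemma site3K i j k : site3 (idx3 i j k) = k.
Proof. by rewrite /site3 !mxtens_indexK. Qed.

Lemma idx3_eq (c : 'I_(n * n * n)) i j k :
  (c == idx3 i j k) = [&& site1 c == i, site2 c == j & site3 c == k].
Proof.
apply/eqP/and3P => [->|[/eqP<- /eqP<- /eqP<-]]; last exact: idx3P.
by rewrite site1K site2K site3K.
Qed.

Lemma idx2_eq a b i j :
  (mxtens_index (a, b) == idx2 i j :> 'I_(n * n)) = (a == i) && (b == j).
Proof.
by rewrite (can_eq (@mxtens_indexK n n)) xpair_eqE.
Qed.

(** Row [(i, j)] is supported on the words [ij], [ji], [jj], [ii], so [D], [P], [S], [T] are the
    coefficients of $E_{ii}\otimes E_{jj}$, $E_{ij}\otimes E_{ji}$, $E_{ij}\otimes E_{jj}$,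
    $E_{ii}\otimes E_{ji}$. For [i = j] the four words coincide and the coefficients add up. *)
Definition wordmx D P S T : 'M[K]_(n * n) :=
  \matrix_(r, c) let: (i, j) := mxtens_unindex r in
    D i j * (c == idx2 i j)%:R + P i j * (c == idx2 j i)%:R
    + S i j * (c == idx2 j j)%:R + T i j * (c == idx2 i i)%:R.

Lemma sum_delta m (M : 'M[K]_m) (d : K) (a c : 'I_m) :
  \sum_k d * (k == a)%:R * M k c = d * M a c.
Proof.
rewrite (bigD1 a) //= eqxx mulr1 big1 ?addr0 // => k /negbTE ->.
by rewrite mulr0 mul0r.
Qed.

Lemma mul4E m (M A : 'M[K]_m) (d1 d2 d3 d4 : K) (a1 a2 a3 a4 r c : 'I_m) :
  (forall k : 'I_m, A r k = d1 * (k == a1)%:R + d2 * (k == a2)%:R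
    + d3 * (k == a3)%:R + d4 * (k == a4)%:R) ->
  (A *m M) r c = d1 * M a1 c + d2 * M a2 c + d3 * M a3 c + d4 * M a4 c.
Proof.
move=> AE; rewrite mxE -!sum_delta -!big_split /=; apply: eq_bigr => k _.
by rewrite AE !mulrDl.
Qed.

(** Left multiplication by a leg only combines rows of the right factor. As [M] is arbitrary,
    products of legs expand by repeated rewriting while the column [c] stays generic. *)
Lemma leg12_mulE D P S T (M : 'M[K]_(n * n * n)) i j k c :
  (leg12 (wordmx D P S T) *m M) (idx3 i j k) c =
    D i j * M (idx3 i j k) c + P i j * M (idx3 j i k) c
    + S i j * M (idx3 j j k) c + T i j * M (idx3 i i k) c.
Proof.
apply: mul4E => l.
rewrite !mxE mxtens_indexK !(site1K,site2K,site3K) /= !idx3_eq !idx2_eq.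
by rewrite !mulrDl -!mulrA -!natrM !mulnb -!andbA (eq_sym k).
Qed.

Lemma leg13_mulE D P S T (M : 'M[K]_(n * n * n)) i j k c :
  (leg13 (wordmx D P S T) *m M) (idx3 i j k) c =
    D i k * M (idx3 i j k) c + P i k * M (idx3 k j i) c
    + S i k * M (idx3 k j k) c + T i k * M (idx3 i j i) c.
Proof.
apply: mul4E => l.
rewrite !mxE mxtens_indexK !(site1K,site2K,site3K) /= !idx3_eq !idx2_eq.
rewrite !mulrDl -!mulrA -!natrM !mulnb (eq_sym j).
by rewrite -!andbA ![(site3 l == _) && _]andbC.
Qed.

Lemma leg23_mulE D P S T (M : 'M[K]_(n * n * n)) i j k c :
  (leg23 (wordmx D P S T) *m M) (idx3 i j k) c =
    D j k * M (idx3 i j k) c + P j k * M (idx3 i k j) c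
    + S j k * M (idx3 i k k) c + T j k * M (idx3 i j j) c.
Proof.
apply: mul4E => l.
rewrite !mxE mxtens_indexK !(site1K,site2K,site3K) /= !idx3_eq !idx2_eq.
rewrite !mulrDl -!mulrA -!natrM !mulnb (eq_sym i).
by rewrite ![_ && (site1 l == _)]andbC.
Qed.

Definition leg_mulE := (leg12_mulE, leg13_mulE, leg23_mulE).

(** This is the product formula at [M = 1]. The entries of [1%:M] play the role of basis words and
    are the atoms in which the four identities are compared. *)
Lemma leg12E D P S T i j k c :
  leg12 (wordmx D P S T) (idx3 i j k) c =
    D i j * 1%:M (idx3 i j k) c + P i j * 1%:M (idx3 j i k) c
    + S i j * 1%:M (idx3 j j k) c + T i j * 1%:M (idx3 i i k) c.
Proof. by rewrite -leg12_mulE mulmx1. Qed.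

Lemma leg13E D P S T i j k c :
  leg13 (wordmx D P S T) (idx3 i j k) c =
    D i k * 1%:M (idx3 i j k) c + P i k * 1%:M (idx3 k j i) c
    + S i k * 1%:M (idx3 k j k) c + T i k * 1%:M (idx3 i j i) c.
Proof. by rewrite -leg13_mulE mulmx1. Qed.

Lemma leg23E D P S T i j k c :
  leg23 (wordmx D P S T) (idx3 i j k) c =
    D j k * 1%:M (idx3 i j k) c + P j k * 1%:M (idx3 i k j) c
    + S j k * 1%:M (idx3 i k k) c + T j k * 1%:M (idx3 i j j) c.
Proof. by rewrite -leg23_mulE mulmx1. Qed.

Definition legE := (leg12E, leg13E, leg23E).

(** Each [H k] is a diagonal projector whose row [r] is nonzero only for [k = a], so the sum selects
    the single derivative taken along the letter of the row at that site. *)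
Lemma sum_mulmxE m (H : 'I_n -> 'M[K]_m) (M : 'I_n -> 'M[K]_m) a r c :
  (forall k s, H k r s = (k == a)%:R * (s == r)%:R) ->
  (\sum_k H k *m M k) r c = M a r c.
Proof.
move=> HE; rewrite summxE (bigD1 a) //= big1 ?addr0 => [|k ka].
  rewrite mxE (bigD1 r) //= HE !eqxx !mul1r big1 ?addr0 // => s sr.
  by rewrite HE (negbTE sr) mulr0 mul0r.
by rewrite mxE big1 // => s _; rewrite HE (negbTE ka) !mul0r.
Qed.

Lemma h1E (l : 'I_n) (r s : 'I_(n * n * n)) :
  h1 K l r s = (l == site1 r)%:R * (s == r)%:R.
Proof.
rewrite [X in s == X]idx3P idx3_eq !mxE -/(site1 r) -/(site2 r) -/(site3 r).
rewrite -/(site1 s) -/(site2 s) -/(site3 s) (eq_sym (site2 s)) (eq_sym (site3 s)).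
rewrite -!natrM !mulnb.
by case: (eqVneq l) => [->|_]; rewrite /= ?andbA ?andbF.
Qed.

Lemma h2E (l : 'I_n) (r s : 'I_(n * n * n)) :
  h2 K l r s = (l == site2 r)%:R * (s == r)%:R.
Proof.
rewrite [X in s == X]idx3P idx3_eq !mxE -/(site1 r) -/(site2 r) -/(site3 r).
rewrite -/(site1 s) -/(site2 s) -/(site3 s) (eq_sym (site1 s)) (eq_sym (site3 s)).
rewrite -!natrM !mulnb.
by case: (eqVneq l) => [->|_]; rewrite /= ?andbA ?andbF.
Qed.

Lemma h3E (l : 'I_n) (r s : 'I_(n * n * n)) :
  h3 K l r s = (l == site3 r)%:R * (s == r)%:R.
Proof.
rewrite [X in s == X]idx3P idx3_eq !mxE -/(site1 r) -/(site2 r) -/(site3 r).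
rewrite -/(site1 s) -/(site2 s) -/(site3 s) (eq_sym (site1 s)) (eq_sym (site2 s)).
rewrite -!natrM !mulnb.
by case: (eqVneq l) => [->|_]; rewrite /= ?andbA ?andbF.
Qed.

Lemma sum_h1E (M : 'I_n -> 'M[K]_(n * n * n)) i j k c :
  (\sum_l h1 _ l *m M l) (idx3 i j k) c = M i (idx3 i j k) c.
Proof. by apply: sum_mulmxE => l s; rewrite h1E site1K. Qed.

Lemma sum_h2E (M : 'I_n -> 'M[K]_(n * n * n)) i j k c :
  (\sum_l h2 _ l *m M l) (idx3 i j k) c = M j (idx3 i j k) c.
Proof. by apply: sum_mulmxE => l s; rewrite h2E site2K. Qed.

Lemma sum_h3E (M : 'I_n -> 'M[K]_(n * n * n)) i j k c :
  (\sum_l h3 _ l *m M l) (idx3 i j k) c = M k (idx3 i j k) c.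
Proof. by apply: sum_mulmxE => l s; rewrite h3E site3K. Qed.

Lemma lieE m (A B : 'M[K]_m) r c : lie A B r c = (A *m B) r c - (B *m A) r c.
Proof. by rewrite !mxE. Qed.

Lemma idx2P (r : 'I_(n * n)) : exists i j, r = idx2 i j.
Proof.
exists (mxtens_unindex r).1, (mxtens_unindex r).2.
by rewrite /idx2 -surjective_pairing mxtens_unindexK.
Qed.

Lemma delta_tensmx (i j k l : 'I_n) :
  delta_mx i j *t delta_mx k l = delta_mx (idx2 i k) (idx2 j l) :> 'M[K]_(n * n).
Proof.
apply/matrixP => r c; have [a [b ->]] := idx2P r; have [a' [b' ->]] := idx2P c.
by rewrite tensmxE !mxE !idx2_eq -natrM mulnb andbACA.
Qed.

Lemma sum_delta_tensmx (G : 'I_n -> 'I_n -> K) (u : 'I_n -> 'I_n -> 'I_(n * n))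
    (i j : 'I_n) (c : 'I_(n * n)) :
  (\sum_a \sum_b G a b *: (delta_mx (idx2 a b) (u a b) : 'M[K]_(n * n)))
    (idx2 i j) c = G i j * (c == u i j)%:R.
Proof.
rewrite summxE (bigD1 i) //= [X in _ + X]big1 => [|a ai]; last first.
  rewrite summxE big1 // => b _.
  by rewrite !mxE idx2_eq (eq_sym i) (negbTE ai) mulr0.
rewrite addr0 summxE (bigD1 j) //= big1 => [|b bj]; last first.
  by rewrite !mxE idx2_eq (eq_sym j) (negbTE bj) andbF mulr0.
by rewrite addr0 !mxE eqxx.
Qed.

(** A coefficient vanishing on the diagonal lets the restricted sum run over all pairs, which is the
    shape of a word matrix. *)
Lemma sum_offdiag (V : lmodType K) (G : 'I_n -> 'I_n -> K) (W : 'I_n -> 'I_n -> V) :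
  (forall i, G i i = 0) ->
  \sum_i \sum_(j | i != j) G i j *: W i j = \sum_i \sum_j G i j *: W i j.
Proof.
move=> G0; apply: eq_bigr => i _; rewrite [RHS](bigID (fun j => i != j)) /=.
rewrite [X in _ + X]big1 ?addr0 // => j; rewrite negbK => /eqP <-.
by rewrite G0 scale0r.
Qed.

Lemma wordmxE (D P S T : 'I_n -> 'I_n -> K) i j c :
  wordmx D P S T (idx2 i j) c =
    D i j * (c == idx2 i j)%:R + P i j * (c == idx2 j i)%:R
    + S i j * (c == idx2 j j)%:R + T i j * (c == idx2 i i)%:R.
Proof. by rewrite mxE mxtens_indexK. Qed.

Lemma mx3_eq0 (E : 'M[K]_(n * n * n)) :
  (forall i j k c, E (idx3 i j k) c = 0) -> E = 0.
Proof. by move=> E0; apply/matrixP => r c; rewrite (idx3P r) E0 mxE. Qed.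

(** The five coincidence patterns of a three-letter word; different relations between the
    coefficients are available in each. *)
Lemma sites_ind (P : 'I_n -> 'I_n -> 'I_n -> Prop) :
  (forall i, P i i i) -> (forall i j, i != j -> P i i j) ->
  (forall i j, i != j -> P i j j) -> (forall i j, i != j -> P i j i) ->
  (forall i j k, i != j -> j != k -> i != k -> P i j k) ->
  forall i j k, P i j k.
Proof.
move=> Piii Piij Pijj Piji Pijk i j k.
have [<-|ij] := eqVneq i j; first by have [<-|] := eqVneq i k; auto.
by have [<-|jk] := eqVneq j k; [|have [<-|] := eqVneq i k]; auto.
Qed.

End WordMatrices.

(** * The identities for an abstract hyperbolic family *)

Section HyperbolicFamily.
Variables (K : comNzRingType) (n : nat) (F S : 'I_n -> 'I_n -> K).

(** The [- 1] beside [F] comes from the Casimir term. Both [S] coefficients carry a minus sign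
    because flipping $s$ exchanges the letters and $1/\sinh$ is odd. *)
Definition amx := wordmx F (fun i j => F i j - 1)
  (fun i j => - S i j) (fun i j => - S i j).
Definition bmx := wordmx (fun i j => - F i j) (fun _ _ => 0) (fun _ _ => 0) S.
Definition cmx := wordmx F (fun _ _ => 0) (fun i j => - S i j) (fun _ _ => 0).
Definition dmx := wordmx (fun i j => - F i j) (fun i j => F i j - 1)
  (fun _ _ => 0) (fun _ _ => 0).

(* [dF k] and [dS k] are the partial derivatives along q_k of
   F i j = coth (q_i - q_j) and S i j = 1 / sinh (q_i - q_j). *)
Definition dF k i j : K := - (S i j * S i j) * ((i == k)%:R - (j == k)%:R).
Definition dS k i j : K := - (F i j * S i j) * ((i == k)%:R - (j == k)%:R).
Definition damx k := wordmx (dF k) (dF k)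
  (fun i j => - dS k i j) (fun i j => - dS k i j).
Definition dbmx k := wordmx (fun i j => - dF k i j) (fun _ _ => 0)
  (fun _ _ => 0) (dS k).
Definition ddmx k := wordmx (fun i j => - dF k i j) (dF k)
  (fun _ _ => 0) (fun _ _ => 0).

Hypothesis F0 : forall i, F i i = 0.
Hypothesis S0 : forall i, S i i = 0.
Hypothesis FN : forall i j, F j i = - F i j.
Hypothesis SN : forall i j, S j i = - S i j.
Hypothesis S2E : forall i j, i != j -> S i j * S i j = F i j * F i j - 1.
Hypothesis FFE : forall i j k, i != j -> j != k -> i != k ->
  F i j * F j k = F i k * (F i j + F j k) - 1.
Hypothesis SSE : forall i j k, i != j -> j != k -> i != k ->
  S i j * S j k = S i k * (F i j + F j k).

(* The side relations are oriented so that the leading monomials join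
   neighbours in S j k, F j k, F i k, S i j, S i k, F i j, the order in which
   the call of [ring] in [ring_triple] first meets the variables: rewriting with
   a monomial x y is incomplete when other variables lie between x and y. *)
Let FSE i j k : i != j -> j != k -> i != k ->
  F i k * S i j = S i j * F j k - S i k * S j k.
Proof.
(* The addition relation along [i, k, j], brought back to the pairs [ij], [jk], [ik] by oddness. *)
move=> ij jk ik; have := SSE (i := i) (j := k) (k := j).
rewrite (FN j k) (SN j k) (eq_sym k) => /(_ ik jk ij).
by move=> E; rewrite -[S i k * S j k]opprK -mulrN E; ring.
Qed.

Let FFE' i j k : i != j -> j != k -> i != k ->
  F j k * F i k = F i j * F j k - F i k * F i j + 1.
Proof. by move=> ij jk ik; rewrite FFE //; ring. Qed.

Let SSE' i j k : i != j -> j != k -> i != k ->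
  S i j * S i k = S j k * F i j - S j k * F i k.
Proof.
move=> ij jk ik; have := SSE (i := j) (j := i) (k := k).
rewrite (FN i j) (SN i j) (eq_sym j) => /(_ ij ik jk).
by move=> E; rewrite -[LHS]opprK -mulNr E; ring.
Qed.

Let SFE i j k : i != j -> j != k -> i != k ->
  S i k * F i j = S i j * S j k - S i k * F j k.
Proof. by move=> ij jk ik; rewrite SSE //; ring. Qed.

(** Oddness leaves one [F] and one [S] for each unordered pair of letters, and the Kronecker symbols
    produced by the derivatives become numbers. *)
Ltac orient ij :=
  match type of ij with is_true (?i != ?j) =>
    rewrite ?(FN i j) ?(SN i j) ?(eq_sym j i) ?(negbTE ij) /=
  end.

Ltac expand_entries :=
  rewrite ?(addmxE, oppmxE) ?lieE ?(sum_h1E, sum_h2E, sum_h3E) ?leg_mulE ?legE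
    ?F0 ?S0 /dF /dS ?eqxx /=.

(** Two distinct letters give a single pair, on which the only relation is [S2E]. *)
Ltac ring_pair ij := expand_entries; orient ij; ring: (S2E ij).

Ltac ring_triple ij jk ik :=
  expand_entries; orient ij; orient jk; orient ik;
  ring: (S2E jk) (FSE ij jk ik) (FFE' ij jk ik) (SSE' ij jk ik) (SFE ij jk ik)
    (S2E ij) (S2E ik).

Lemma ybe_aa :
  lie (leg12 amx) (leg13 amx) + lie (leg12 amx) (leg23 amx)
    + lie (leg13 amx) (leg23 amx) = 0.
Proof.
apply: mx3_eq0; apply: sites_ind
  => [i|i j ij|i j ij|i j ij|i j k ij jk ik] c.
(* On a word [iii] each leg acts by a scalar, so the commutators vanish. *)
- by expand_entries; ring.
- ring_pair ij.
- ring_pair ij.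
- ring_pair ij.
- ring_triple ij jk ik.
Qed.

(** In row [(i, j, k)] each derivative is taken along the letter of the site on which the
    differentiated leg acts trivially. It vanishes for distinct letters, so the derivative terms can
    contribute only when letters coincide. *)
Lemma ybe_dd :
  lie (leg12 dmx) (leg13 dmx) + lie (leg12 dmx) (leg23 dmx)
    + lie (leg13 dmx) (leg23 dmx)
    + \sum_l h1 _ l *m leg23 (ddmx l)
    - \sum_l h2 _ l *m leg13 (ddmx l)
    + \sum_l h3 _ l *m leg12 (ddmx l) = 0.
Proof.
apply: mx3_eq0; apply: sites_ind
  => [i|i j ij|i j ij|i j ij|i j k ij jk ik] c.
- by expand_entries; ring.
- ring_pair ij.
- ring_pair ij.
- ring_pair ij.
- ring_triple ij jk ik.
Qed.

Lemma ybe_db :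
  lie (leg12 dmx) (leg13 bmx) + lie (leg12 dmx) (leg23 bmx)
    + lie (leg13 bmx) (leg23 bmx)
    + \sum_l h1 _ l *m leg23 (dbmx l)
    - \sum_l h2 _ l *m leg13 (dbmx l) = 0.
Proof.
apply: mx3_eq0; apply: sites_ind
  => [i|i j ij|i j ij|i j ij|i j k ij jk ik] c.
- by expand_entries; ring.
- ring_pair ij.
- ring_pair ij.
- ring_pair ij.
- ring_triple ij jk ik.
Qed.

Lemma ybe_ac :
  lie (leg12 amx) (leg13 cmx) + lie (leg12 amx) (leg23 cmx)
    + lie (leg13 cmx) (leg23 cmx)
    - \sum_l h3 _ l *m leg12 (damx l) = 0.
Proof.
apply: mx3_eq0; apply: sites_ind
  => [i|i j ij|i j ij|i j ij|i j k ij jk ik] c.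
- by expand_entries; ring.
- ring_pair ij.
- ring_pair ij.
- ring_pair ij.
- ring_triple ij jk ik.
Qed.

End HyperbolicFamily.

(** * Complex hyperbolic functions and their derivatives *)

Section ComplexExponential.
Local Open Scope classical_set_scope.
Variable R : realType.
Implicit Types z w : R[i].

Lemma expcD z w : expc (z + w) = expc z * expc w.
Proof.
case: z w => [a b] [c d]; apply/eqP; rewrite eq_complex /= expRD cosD sinD.
by apply/andP; split; apply/eqP; ring.
Qed.

Lemma expc0 : expc (0 : R[i]) = 1.
Proof.
by apply/eqP; rewrite eq_complex /= expR0 cos0 sin0 mulr1 mulr0 !eqxx.
Qed.

Lemma expcN_mul z : expc z * expc (- z) = 1.
Proof. by rewrite -expcD subrr expc0. Qed.

Lemma sinhcN z : sinhc (- z) = - sinhc z.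
Proof. by rewrite /sinhc opprK; ring. Qed.
Lemma coshcN z : coshc (- z) = coshc z.
Proof. by rewrite /coshc opprK addrC. Qed.
Lemma cothcN z : cothc (- z) = - cothc z.
Proof. by rewrite /cothc coshcN sinhcN invrN mulrN. Qed.

Lemma sinhc0 : sinhc (0 : R[i]) = 0.
Proof. by rewrite /sinhc oppr0 subrr mul0r. Qed.

(** The inverse of zero is zero, so the pole takes the value 0; this supplies the vanishing diagonal
    coefficients. *)
Lemma cothc0 : cothc (0 : R[i]) = 0.
Proof. by rewrite /cothc sinhc0 invr0 mulr0. Qed.

Lemma coshc_sqr z : coshc z ^+ 2 = sinhc z ^+ 2 + 1.
Proof.
rewrite /coshc /sinhc.
have -> : ((expc z + expc (- z)) / 2) ^+ 2
  = ((expc z - expc (- z)) / 2) ^+ 2 + expc z * expc (- z) by field.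
by rewrite expcN_mul.
Qed.

Lemma sinhcD z w : sinhc (z + w) = sinhc z * coshc w + coshc z * sinhc w.
Proof. by rewrite /sinhc /coshc opprD !expcD; field. Qed.

Lemma coshcD z w : coshc (z + w) = coshc z * coshc w + sinhc z * sinhc w.
Proof. by rewrite /sinhc /coshc opprD !expcD; field. Qed.

Lemma cscc_sqr z : sinhc z != 0 ->
  (sinhc z)^-1 * (sinhc z)^-1 = cothc z * cothc z - 1.
Proof.
move=> z0; rewrite /cothc [in RHS]mulrACA -!expr2 coshc_sqr; field.
exact: z0.
Qed.

Lemma cothc_mul z w : sinhc z != 0 -> sinhc w != 0 -> sinhc (z + w) != 0 ->
  cothc z * cothc w = cothc (z + w) * (cothc z + cothc w) - 1.
Proof.
move=> z0 w0; rewrite /cothc sinhcD coshcD => zw0; field.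
by rewrite z0 w0.
Qed.

Lemma cscc_mul z w : sinhc z != 0 -> sinhc w != 0 -> sinhc (z + w) != 0 ->
  (sinhc z)^-1 * (sinhc w)^-1 = (sinhc (z + w))^-1 * (cothc z + cothc w).
Proof.
move=> z0 w0; rewrite /cothc sinhcD => zw0; field.
by rewrite z0 w0.
Qed.

(** The derivative as a remainder bound on a full neighbourhood of 0, the form in which real
    estimates can be combined into a complex one. *)
Lemma is_derive_remainder (f : R -> R) (x df : R) : is_derive x 1 f df ->
  forall e : R, 0 < e ->
  \forall h \near 0, `|f (x + h) - f x - df * h| <= e * `|h|.
Proof.
move=> [fx <-] e e0.
have /cvgrPdist_le/(_ e e0) := fx.
rewrite near_withinE /= => H; near=> h.
have [->|h0] := eqVneq h 0.
  by rewrite addr0 subrr sub0r mulr0 normrN normr0 mulr0 lexx.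
have : `|'D_1 f x - h^-1 *: (f (h *: 1 + x) - f x)| <= e.
  by move: h0; near: h; exact: H.
rewrite [_%:A]mulr1 -(ler_pM2r (_ : 0 < `|h|)) ?normr_gt0 //; apply: le_trans.
rewrite -normrM mulrBl -[_ *: _]/(_ * _) mulrAC mulVf // mul1r (addrC x h).
by rewrite distrC.
Unshelve. all: by end_near. Qed.

Lemma normc_le z : `|z| <= (`|complex.Re z| + `|complex.Im z|)%:C%C.
Proof.
case: z => a b; rewrite normc_def lecR /=.
rewrite -(ler_pXn2r (_ : 0 < 2)%N) ?nnegrE ?addr_ge0 ?sqrtr_ge0 //.
rewrite sqr_sqrtr ?addr_ge0 ?sqr_ge0 //.
rewrite sqrrD !real_normK ?num_real // lerD2r lerDl.
by rewrite mulrn_wge0 // mulr_ge0.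
Qed.

Lemma normc_ge_Im z : `|complex.Im z|%:C%C <= `|z|.
Proof.
case: z => a b; rewrite normc_def lecR /= -sqrtr_sqr ler_wsqrtr //.
by rewrite lerDr sqr_ge0.
Qed.

Lemma near_normc (P : set R) : (\forall h \near 0, P h) ->
  exists2 d : R, 0 < d &
    forall z, `|z| < d%:C%C -> P (complex.Re z) /\ P (complex.Im z).
Proof.
move=> /nbhs_ballP [d /= d0 dP]; exists d => // z zd.
split; apply: dP; rewrite /ball /= sub0r normrN -ltcR; apply: le_lt_trans zd.
  exact: normc_ge_Re.
exact: normc_ge_Im.
Qed.

(** Complex differentiability of the exponential at 0, from the first-order remainders of the real
    [expR], [cos] and [sin] at 0 applied to the real and imaginary parts. *)
Lemma expc_remainder (e : R) : 0 < e -> exists2 d : R, 0 < d &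
  forall z, `|z| < d%:C%C -> `|expc z - 1 - z| <= e%:C%C * `|z|.
Proof.
move=> e0.
(* The real part below costs at most $u|x|+3u|y|$ and the imaginary part $5u|y|$, in total at most
   $9u|z|$; the bound $u\le 1$ serves to get $|e^x|\le 3$. *)
pose u := Num.min (e / 9) 1.
have u0 : 0 < u by rewrite lt_min divr_gt0 ?ltr01.
have ue : 9 * u <= e by rewrite mulrC -ler_pdivlMr // ge_min lexx.
have u1 : u <= 1 by rewrite ge_min lexx orbT.
clearbody u.
have /near_normc[d1 d1_gt0 Hexp] :=
  is_derive_remainder (is_derive_expR (0 : R)) u0.
have /near_normc[d2 d2_gt0 Hcos] :=
  is_derive_remainder (is_derive_cos (0 : R)) u0.
have /near_normc[d3 d3_gt0 Hsin] :=
  is_derive_remainder (is_derive_sin (0 : R)) u0.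
(* Including [u] in the radius forces $|x|<u$, whence $|e^x-1|\le 2u$. *)
exists (Num.min (Num.min d1 d2) (Num.min d3 u)) => [|z zd].
  by rewrite 2!lt_min d1_gt0 d2_gt0 lt_min d3_gt0 u0.
have zlt m : Num.min (Num.min d1 d2) (Num.min d3 u) <= m -> `|z| < m%:C%C.
  by move=> lem; apply: lt_le_trans zd _; rewrite lecR.
have /Hexp[Hx _] : `|z| < d1%:C%C by rewrite zlt // !ge_min lexx.
have /Hcos[_ Hy] : `|z| < d2%:C%C by rewrite zlt // !ge_min lexx orbT.
have /Hsin[_ Hs] : `|z| < d3%:C%C by rewrite zlt // !ge_min lexx !orbT.
have xu : `|complex.Re z| < u.
  rewrite -ltcR (le_lt_trans (normc_ge_Re z)) // zlt //.
  by rewrite !ge_min lexx !orbT.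
move: Hx Hy Hs.
rewrite !add0r expR0 cos0 sin0 oppr0 mul0r mul1r !subr0 mul1r.
have := normc_ge_Re z; have := normc_ge_Im z.
move: xu => {zlt zd Hexp Hcos Hsin}.
case: z => x y /=; rewrite addr0 => xu ynorm xnorm Hx Hy Hs.
apply: le_trans (normc_le _) _; rewrite /expc /=.
rewrite oppr0 addr0.
have x0 := normr_ge0 x; have y0 := normr_ge0 y.
have ex : `|expR x| <= 3.
  have -> : expR x = (expR x - 1 - x) + x + 1 by ring.
  rewrite (le_trans (ler_normD _ _)) // normr1.
  rewrite (le_trans (lerD (ler_normD _ _) (lexx _))) //.
  have : u * `|x| <= 1 by rewrite mulr_ile1 // ltW // (lt_le_trans xu).
  by move: Hx xu u1; lra.
have ex1 : `|expR x - 1| <= 2 * u.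
  have -> : expR x - 1 = (expR x - 1 - x) + x by ring.
  rewrite (le_trans (ler_normD _ _)) //.
  have : u * `|x| <= u * 1 by rewrite ler_pM2l // ltW // (lt_le_trans xu).
  by move: xu Hx; lra.
have re_le : `|expR x * cos y - 1 - x| <= u * `|x| + 3 * (u * `|y|).
  have -> : expR x * cos y - 1 - x = (expR x - 1 - x) + expR x * (cos y - 1).
    by ring.
  by rewrite (le_trans (ler_normD _ _)) // lerD // normrM ler_pM.
(* The constant 5 is 3 from $|e^x|\le 3$ plus 2 from $|e^x-1|\le 2u$. *)
have im_le : `|expR x * sin y - y| <= 5 * (u * `|y|).
  have -> : expR x * sin y - y = expR x * (sin y - y) + (expR x - 1) * y.
    by ring.
  rewrite (le_trans (ler_normD _ _)) // !normrM.
  have := ler_pM (normr_ge0 _) (normr_ge0 _) ex Hs.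
  have := ler_pM (normr_ge0 _) y0 ex1 (lexx _).
  by lra.
apply: (@le_trans _ _ ((u * `|x| + 8 * (u * `|y|))%:C%C)).
  by rewrite lecR; lra.
apply: (@le_trans _ _ ((9 * u)%:C%C * `|(x +i* y)%C|)); last first.
  by rewrite ler_wpM2r // lecR.
have -> : (9 * u)%:C%C * `|(x +i* y)%C| =
  u%:C%C * `|(x +i* y)%C| + (8 * u)%:C%C * `|(x +i* y)%C| :> R[i].
  by rewrite -mulrDl -rmorphD /=; congr (_%:C%C * _); ring.
rewrite mulrA rmorphD !rmorphM /= lerD // ler_wpM2l //.
  by rewrite ler0c ltW.
by rewrite -rmorphM ler0c ltW // mulr_gt0.
Qed.

End ComplexExponential.

(** * Directional derivatives as limits, and entrywise differentiation of matrices *)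

Section Derivatives.
Local Open Scope classical_set_scope.

Lemma cvg_is_derive (K : numFieldType) (V W : normedModType K) (f : V -> W)
    (q v : V) (df : W) :
  (h^-1 *: (f (h *: v + q) - f q) @[h --> 0^']) --> df -> is_derive q v f df.
Proof. by move=> fdf; split; [apply/cvg_ex; exists df | exact/cvg_lim]. Qed.

(** A neighbourhood of a matrix contains a product of neighbourhoods of its entries, and there are
    finitely many entries, so the entrywise limits combine. *)
Lemma is_derive_mx (K : numFieldType) (V : normedModType K) m p
    (f : V -> 'M[K]_(m, p)) (q v : V) (df : 'M[K]_(m, p)) :
  (forall i j, is_derive q v (fun x => f x i j) (df i j)) ->
  is_derive q v f df.
Proof.
move=> fdf; apply: cvg_is_derive => A [P dfP PA].
have : \forall h \near 0^', forall ij : 'I_m * 'I_p,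
    P ij.1 ij.2 ((h^-1 *: (f (h *: v + q) - f q)) ij.1 ij.2).
  apply: filter_forall => -[i j] /=; have [fij fijE] := fdf i j.
  have fdfij : (h^-1 *: (f (h *: v + q) i j - f q i j) @[h --> 0^'])
      --> df i j by rewrite -fijE.
  have Pij : \forall h \near 0^',
      P i j (h^-1 *: (f (h *: v + q) i j - f q i j)).
    exact: (fdfij _ (dfP i j)).
  by near=> h; rewrite !mxE; near: h.
move=> H; suff : \forall h \near 0^', A (h^-1 *: (f (h *: v + q) - f q)) by [].
by apply: filterS H => h hP; apply: PA => i j; exact: (hP (i, j)).
Unshelve. all: by end_near. Qed.

End Derivatives.

(** * Exponential and hyperbolic functions along a line *)

Section ExpDerive.
Local Open Scope classical_set_scope.
Variables (R : realType) (V : normedModType R[i]).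
Variables (l : V -> R[i]) (q v : V) (c : R[i]).
Hypothesis l_affine : forall h, l (h *: v + q) = h * c + l q.

Let K : numFieldType := R[i].

(** Since [l] is affine along the line, the difference quotient factors as
    $h^{-1}(e^{hc}-1)\,e^{l(q)}$, and only the behaviour of the exponential at 0 matters. *)
Lemma is_derive_expc : @is_derive K V K q v (fun x => expc (l x)) (c * expc (l q)).
Proof.
apply: cvg_is_derive.
rewrite (_ : (fun h => _) =
    (fun h => (h^-1 * (expc (h * c) - 1)) * expc (l q))); last first.
  apply/funext => h; rewrite l_affine expcD -[_ *: _]/(_ * _).
  by rewrite -mulrA mulrBl mul1r.
apply: cvgM; last exact: cvg_cst.
apply/cvgrPdist_le => eps eps0.
(* A positive element of [R[i]] has zero imaginary part, so the tolerance is a real number. *)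
have [e e0 ->] : exists2 e : R, 0 < e & eps = e%:C%C.
  exists (complex.Re eps); first by move: eps0; rewrite ltcE => /andP[].
  by move: eps0; case: (eps) => a b; rewrite ltcE /= => /andP[/eqP-> _].
(* A strictly positive bound for $|c|$, so that dividing by [k] is safe even when [c] is zero. *)
have [k k0 kc] : exists2 k : R, 0 < k & `|c| <= k%:C%C.
  exists (`|complex.Re c| + `|complex.Im c| + 1).
    by rewrite ltr_wpDl // addr_ge0.
  by apply: le_trans (normc_le c) _; rewrite lecR lerDl.
have ek0 : 0 < e / k by rewrite divr_gt0.
have [d d0 dP] := expc_remainder ek0.
near=> h.
have h0 : h != 0 by near: h; exact: nbhs_dnbhs_neq.
have hd : `|h| < (d / k)%:C%C.
  by near: h; apply: dnbhs0_lt; rewrite ltcR divr_gt0.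
have : `|h * c| < d%:C%C.
  rewrite normrM (le_lt_trans (ler_wpM2l (normr_ge0 h) kc)) //.
  have -> : d = d / k * k by rewrite divfK // lt0r_neq0.
  by rewrite rmorphM /= ltr_pM2r // ltcR.
move=> /dP H.
rewrite -(ler_pM2l (_ : 0 < `|h|)) ?normr_gt0 // -normrM.
rewrite mulrBr mulrA divff // mul1r distrC.
apply: (le_trans H); rewrite normrM mulrCA ler_wpM2l //.
apply: (@le_trans _ _ ((e / k)%:C%C * k%:C%C)).
  by rewrite ler_wpM2l // ler0c ltW.
by rewrite -rmorphM /= divfK // lt0r_neq0.
Unshelve. all: by end_near. Qed.

End ExpDerive.

Section HyperbolicDerive.
Variables (R : realType) (V : normedModType R[i]).
Variables (l : V -> R[i]) (q v : V) (c : R[i]).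
Hypothesis l_affine : forall h, l (h *: v + q) = h * c + l q.
Let K : numFieldType := R[i].

Let is_derive_expl := is_derive_expc l_affine.
Let is_derive_explN :
  @is_derive K V K q v (fun x => expc (- l x)) (- c * expc (- l q)).
Proof.
by apply: is_derive_expc => h; rewrite l_affine opprD mulrN.
Qed.

Lemma is_derive_sinhc :
  @is_derive K V K q v (fun x => sinhc (l x)) (c * coshc (l q)).
Proof.
have := is_deriveM (is_deriveB is_derive_expl is_derive_explN)
  (is_derive_cst (2^-1 : K) q v).
move/is_derive_eq; apply.
rewrite scaler0 add0r -[_ *: _]/(_ * _) /coshc /cst; ring.
Qed.

Lemma is_derive_coshc :
  @is_derive K V K q v (fun x => coshc (l x)) (c * sinhc (l q)).
Proof.
have := is_deriveM (is_deriveD is_derive_expl is_derive_explN)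
  (is_derive_cst (2^-1 : K) q v).
move/is_derive_eq; apply.
rewrite scaler0 add0r -[_ *: _]/(_ * _) /sinhc /cst; ring.
Qed.

Hypothesis sinh_neq0 : sinhc (l q) != 0.

Lemma is_derive_cscc : @is_derive K V K q v (fun x => (sinhc (l x))^-1)
  (- (cothc (l q) * (sinhc (l q))^-1) * c).
Proof.
have [dS dSE] := is_derive_sinhc.
split; first exact: derivableV.
rewrite deriveV // dSE -[_ *: _]/(_ * _) /cothc; field; exact: sinh_neq0.
Qed.

Lemma is_derive_cothc : @is_derive K V K q v (fun x => cothc (l x))
  (- ((sinhc (l q))^-1 * (sinhc (l q))^-1) * c).
Proof.
have := is_deriveM is_derive_coshc is_derive_cscc.
move/is_derive_eq; apply; rewrite -![_ *: _]/(_ * _).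
rewrite /cothc.
have -> : coshc (l q) * (- (coshc (l q) / sinhc (l q) / sinhc (l q)) * c)
  = - coshc (l q) ^+ 2 / sinhc (l q) ^+ 2 * c by field; exact: sinh_neq0.
rewrite coshc_sqr; field; exact: sinh_neq0.
Qed.

End HyperbolicDerive.

(** * The r-matrix of the model *)

Section RMatrixWords.
Variables (R : realType) (n : nat).
Implicit Types (q : 'rV[R[i]]_n) (i j k : 'I_n).

Definition coth_fam q i j : R[i] := cothc (q 0 i - q 0 j).
Definition csch_fam q i j : R[i] := (sinhc (q 0 i - q 0 j))^-1.

Lemma coth_fam0 q i : coth_fam q i i = 0.
Proof. by rewrite /coth_fam subrr cothc0. Qed.
Lemma csch_fam0 q i : csch_fam q i i = 0.
Proof. by rewrite /csch_fam subrr sinhc0 invr0. Qed.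
Lemma coth_famN q i j : coth_fam q j i = - coth_fam q i j.
Proof. by rewrite /coth_fam -cothcN opprB. Qed.
Lemma csch_famN q i j : csch_fam q j i = - csch_fam q i j.
Proof. by rewrite /csch_fam -invrN -sinhcN opprB. Qed.

(** Unlike $u$, $s$, $w$, this sum includes [i = j], so $\mathcal C$ swaps the letters of every
    word. *)
Lemma casimirE i j c : casimir R n (idx2 i j) c = (c == idx2 j i)%:R.
Proof.
rewrite -[RHS]mul1r -(sum_delta_tensmx (fun _ _ => 1) (fun i j => idx2 j i)).
congr (fun_of_matrix _ _ _); apply: eq_bigr => a _; apply: eq_bigr => b _.
by rewrite scale1r delta_tensmx.
Qed.

Lemma umxE q i j c :
  umx q (idx2 i j) c = - (coth_fam q i j * (c == idx2 j i)%:R).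
Proof.
rewrite -(sum_delta_tensmx (coth_fam q) (fun i j => idx2 j i)) /umx mxE.
rewrite sum_offdiag => [|a]; last exact: coth_fam0.
by do 3! congr (_ _); under eq_bigr do under eq_bigr do rewrite delta_tensmx.
Qed.

Lemma smxE q i j c :
  smx q (idx2 i j) c = csch_fam q i j * (c == idx2 j j)%:R.
Proof.
rewrite -(sum_delta_tensmx (csch_fam q) (fun i j => idx2 j j)) /smx.
rewrite sum_offdiag => [|a]; last exact: csch_fam0.
by under eq_bigr do under eq_bigr do rewrite delta_tensmx.
Qed.

Lemma wmxE q i j c :
  wmx q (idx2 i j) c = coth_fam q i j * (c == idx2 i j)%:R.
Proof.
rewrite -(sum_delta_tensmx (coth_fam q) (fun i j => idx2 i j)) /wmx.
rewrite sum_offdiag => [|a]; last exact: coth_fam0.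
by under eq_bigr do under eq_bigr do rewrite delta_tensmx.
Qed.

Lemma flip_smxE q i j c :
  flip (smx q) (idx2 i j) c = - csch_fam q i j * (c == idx2 i i)%:R.
Proof.
have [a [b ->]] := idx2P c.
by rewrite mxE /swap_index !mxtens_indexK smxE csch_famN !idx2_eq andbC.
Qed.

Lemma raE q : ra q = amx (coth_fam q) (csch_fam q).
Proof.
apply/matrixP => r c; have [i [j ->]] := idx2P r; rewrite /ra /amx wordmxE.
move: (umxE q i j c) (flip_smxE q i j c) (smxE q i j c) (wmxE q i j c) (casimirE i j c).
move: (umx q) (flip (smx q)) (smx q) (wmx q) (casimir R n) => U F S W C.
rewrite !(addmxE, oppmxE) => -> -> -> -> ->.
move: (coth_fam q i j) (csch_fam q i j).
by do 4! move: (_ == _)%:R => ?; move=> x y; ring.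
Qed.

Lemma rbE q : rb q = bmx (coth_fam q) (csch_fam q).
Proof.
apply/matrixP => r c; have [i [j ->]] := idx2P r; rewrite /rb /bmx wordmxE.
move: (flip_smxE q i j c) (wmxE q i j c).
move: (flip (smx q)) (wmx q) => F W.
rewrite !(addmxE, oppmxE) => -> ->.
move: (coth_fam q i j) (csch_fam q i j).
by do 4! move: (_ == _)%:R => ?; move=> x y; ring.
Qed.

Lemma rcE q : rc q = cmx (coth_fam q) (csch_fam q).
Proof.
apply/matrixP => r c; have [i [j ->]] := idx2P r; rewrite /rc /cmx wordmxE.
move: (smxE q i j c) (wmxE q i j c).
move: (smx q) (wmx q) => S W.
rewrite !(addmxE, oppmxE) => -> ->.
move: (coth_fam q i j) (csch_fam q i j).
by do 4! move: (_ == _)%:R => ?; move=> x y; ring.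
Qed.

Lemma rdE q : rd q = dmx (coth_fam q).
Proof.
apply/matrixP => r c; have [i [j ->]] := idx2P r; rewrite /rd /dmx wordmxE.
move: (umxE q i j c) (wmxE q i j c) (casimirE i j c).
move: (umx q) (wmx q) (casimir R n) => U W C.
rewrite !(addmxE, oppmxE) => -> -> ->.
move: (coth_fam q i j) (csch_fam q i j).
by do 4! move: (_ == _)%:R => ?; move=> x y; ring.
Qed.

Section WordDerive.
Variables (V : normedModType R[i]) (q v : V).
Let K : numFieldType := R[i].
Notation der f df := (@is_derive K V K q v f df).

Lemma is_derive_word_entry (f1 f2 f3 f4 : V -> R[i]) (df1 df2 df3 df4 : R[i])
    (w1 w2 w3 w4 : R[i]) :
  der f1 df1 -> der f2 df2 -> der f3 df3 -> der f4 df4 ->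
  der (fun x => f1 x * w1 + f2 x * w2 + f3 x * w3 + f4 x * w4)
    (df1 * w1 + df2 * w2 + df3 * w3 + df4 * w4).
Proof.
have scal f df (w : R[i]) : der f df -> der (fun x => f x * w) (df * w).
  move=> fdf; have /is_derive_eq := is_deriveM fdf (is_derive_cst (w : K) q v).
  by apply; rewrite scaler0 add0r -[_ *: _]/(_ * _) mulrC.
move=> /scal-/(_ w1) D1 /scal-/(_ w2) D2 /scal-/(_ w3) D3 /scal-/(_ w4) D4.
exact: is_deriveD (is_deriveD (is_deriveD D1 D2) D3) D4.
Qed.

Variables (D P S T : V -> 'I_n -> 'I_n -> R[i]).
Variables (dD dP dS dT : 'I_n -> 'I_n -> R[i]).
Hypothesis D_der : forall i j, der (fun x => D x i j) (dD i j).
Hypothesis P_der : forall i j, der (fun x => P x i j) (dP i j).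
Hypothesis S_der : forall i j, der (fun x => S x i j) (dS i j).
Hypothesis T_der : forall i j, der (fun x => T x i j) (dT i j).

(** The words do not depend on the point, so differentiating a leg differentiates its
    coefficients. *)
Lemma derive_leg12 :
  'D_v (fun x => leg12 (wordmx (D x) (P x) (S x) (T x))) q
  = leg12 (wordmx dD dP dS dT).
Proof.
apply: (@derive_val K); apply: is_derive_mx => r c; rewrite (idx3P r).
rewrite leg12E; under eq_fun do rewrite leg12E.
exact: is_derive_word_entry.
Qed.

Lemma derive_leg13 :
  'D_v (fun x => leg13 (wordmx (D x) (P x) (S x) (T x))) q
  = leg13 (wordmx dD dP dS dT).
Proof.
apply: (@derive_val K); apply: is_derive_mx => r c; rewrite (idx3P r).
rewrite leg13E; under eq_fun do rewrite leg13E.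
exact: is_derive_word_entry.
Qed.

Lemma derive_leg23 :
  'D_v (fun x => leg23 (wordmx (D x) (P x) (S x) (T x))) q
  = leg23 (wordmx dD dP dS dT).
Proof.
apply: (@derive_val K); apply: is_derive_mx => r c; rewrite (idx3P r).
rewrite leg23E; under eq_fun do rewrite leg23E.
exact: is_derive_word_entry.
Qed.

End WordDerive.

End RMatrixWords.

(** * Relations and partial derivatives of the coefficients where all $\sinh(q_i-q_j)$ with $i\ne j$
    are nonzero *)

Section RegularPoint.
Variables (R : realType) (n : nat) (q : 'rV[R[i]]_n).
Hypothesis q_regular : forall i j : 'I_n, i != j -> sinhc (q 0 i - q 0 j) != 0.
Let K : numFieldType := R[i].
Notation F := (coth_fam q).
Notation S := (csch_fam q).
Notation der k f df := (@is_derive K _ K q (delta_mx 0 k) f df).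

Lemma csch_fam_sqr i j : i != j -> S i j * S i j = F i j * F i j - 1.
Proof. by move=> ij; apply: cscc_sqr; exact: q_regular. Qed.

Let q_split i j k : q 0 i - q 0 k = (q 0 i - q 0 j) + (q 0 j - q 0 k).
Proof. by rewrite addrA subrK. Qed.

Lemma coth_fam_mul i j k : i != j -> j != k -> i != k ->
  F i j * F j k = F i k * (F i j + F j k) - 1.
Proof.
move=> ij jk ik; rewrite /coth_fam (q_split i j k).
by apply: cothc_mul; rewrite -?q_split; exact: q_regular.
Qed.

Lemma csch_fam_mul i j k : i != j -> j != k -> i != k ->
  S i j * S j k = S i k * (F i j + F j k).
Proof.
move=> ij jk ik; rewrite /csch_fam /coth_fam (q_split i j k).
by apply: cscc_mul; rewrite -?q_split; exact: q_regular.
Qed.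

(** Along the [k]-th coordinate direction $q_i-q_j$ has slope $\delta_{ik}-\delta_{jk}$, the factor
    appearing in [dF] and [dS]. *)
Let diff_affine (k i j : 'I_n) (h : R[i]) :
  (h *: delta_mx 0 k + q) 0 i - (h *: delta_mx 0 k + q) 0 j
  = h * ((i == k)%:R - (j == k)%:R) + (q 0 i - q 0 j).
Proof. by rewrite !mxE /=; ring. Qed.

Lemma is_derive_coth_fam k i j : der k (fun x => coth_fam x i j) (dF S k i j).
Proof.
(* On the diagonal the function is constantly 0, and the slope factor makes the claimed derivative 0
   as well. *)
have [<-|ij] := eqVneq i j.
  under eq_fun do rewrite coth_fam0.
  rewrite /dF subrr mulr0; exact: is_derive_cst.
exact: is_derive_cothc (diff_affine k i j) (q_regular ij).
Qed.

Lemma is_derive_csch_fam k i j : der k (fun x => csch_fam x i j) (dS F S k i j).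
Proof.
have [<-|ij] := eqVneq i j.
  under eq_fun do rewrite csch_fam0.
  rewrite /dS subrr mulr0; exact: is_derive_cst.
exact: is_derive_cscc (diff_affine k i j) (q_regular ij).
Qed.

Let is_derive_coth_famN k i j :
  der k (fun x => - coth_fam x i j) (- dF S k i j).
Proof. exact: is_deriveN (is_derive_coth_fam k i j). Qed.

Let is_derive_coth_fam1 k i j :
  der k (fun x => coth_fam x i j - 1) (dF S k i j).
Proof.
have /is_derive_eq := is_deriveB (is_derive_coth_fam k i j)
  (is_derive_cst (1 : K) q (delta_mx 0 k)).
by apply; rewrite subr0.
Qed.

Let is_derive_csch_famN k i j :
  der k (fun x => - csch_fam x i j) (- dS F S k i j).
Proof. exact: is_deriveN (is_derive_csch_fam k i j). Qed.

Let is_derive_zero k : der k (fun _ => 0) 0.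
Proof. exact: is_derive_cst. Qed.

Lemma partial_leg12_ra k : partial k (fun x => leg12 (ra x)) q = leg12 (damx F S k).
Proof.
under eq_fun do rewrite raE.
exact: (derive_leg12 (is_derive_coth_fam k) (is_derive_coth_fam1 k)
  (is_derive_csch_famN k) (is_derive_csch_famN k)).
Qed.

Lemma partial_leg12_rd k : partial k (fun x => leg12 (rd x)) q = leg12 (ddmx S k).
Proof.
under eq_fun do rewrite rdE.
exact: (derive_leg12 (is_derive_coth_famN k) (is_derive_coth_fam1 k)
  (fun _ _ => is_derive_zero k) (fun _ _ => is_derive_zero k)).
Qed.

Lemma partial_leg13_rb k : partial k (fun x => leg13 (rb x)) q = leg13 (dbmx F S k).
Proof.
under eq_fun do rewrite rbE.
exact: (derive_leg13 (is_derive_coth_famN k) (fun _ _ => is_derive_zero k)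
  (fun _ _ => is_derive_zero k) (is_derive_csch_fam k)).
Qed.

Lemma partial_leg13_rd k : partial k (fun x => leg13 (rd x)) q = leg13 (ddmx S k).
Proof.
under eq_fun do rewrite rdE.
exact: (derive_leg13 (is_derive_coth_famN k) (is_derive_coth_fam1 k)
  (fun _ _ => is_derive_zero k) (fun _ _ => is_derive_zero k)).
Qed.

Lemma partial_leg23_rb k : partial k (fun x => leg23 (rb x)) q = leg23 (dbmx F S k).
Proof.
under eq_fun do rewrite rbE.
exact: (derive_leg23 (is_derive_coth_famN k) (fun _ _ => is_derive_zero k)
  (fun _ _ => is_derive_zero k) (is_derive_csch_fam k)).
Qed.

Lemma partial_leg23_rd k : partial k (fun x => leg23 (rd x)) q = leg23 (ddmx S k).
Proof.
under eq_fun do rewrite rdE.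
exact: (derive_leg23 (is_derive_coth_famN k) (is_derive_coth_fam1 k)
  (fun _ _ => is_derive_zero k) (fun _ _ => is_derive_zero k)).
Qed.

End RegularPoint.

(** * The four identities at a regular point *)

Theorem proposition1 (R : realType) (n : nat) (q : 'rV[R[i]]_n)
  (hq : forall i j : 'I_n, i != j -> sinhc (q 0 i - q 0 j) != 0) :
  [/\ lie (leg12 (ra q)) (leg13 (ra q)) + lie (leg12 (ra q)) (leg23 (ra q))
        + lie (leg13 (ra q)) (leg23 (ra q)) = 0,
      lie (leg12 (rd q)) (leg13 (rd q)) + lie (leg12 (rd q)) (leg23 (rd q))
        + lie (leg13 (rd q)) (leg23 (rd q))
        + \sum_k h1 _ k *m partial k (fun x => leg23 (rd x)) q
        - \sum_k h2 _ k *m partial k (fun x => leg13 (rd x)) q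
        + \sum_k h3 _ k *m partial k (fun x => leg12 (rd x)) q = 0,
      lie (leg12 (rd q)) (leg13 (rb q)) + lie (leg12 (rd q)) (leg23 (rb q))
        + lie (leg13 (rb q)) (leg23 (rb q))
        + \sum_k h1 _ k *m partial k (fun x => leg23 (rb x)) q
        - \sum_k h2 _ k *m partial k (fun x => leg13 (rb x)) q = 0
    & lie (leg12 (ra q)) (leg13 (rc q)) + lie (leg12 (ra q)) (leg23 (rc q))
        + lie (leg13 (rc q)) (leg23 (rc q))
        - \sum_k h3 _ k *m partial k (fun x => leg12 (ra x)) q = 0].
Proof.
have F0 := coth_fam0 q; have S0 := csch_fam0 q.
have FN := coth_famN q; have SN := csch_famN q.
have SS := csch_fam_sqr hq.
have FF := coth_fam_mul hq; have SF := csch_fam_mul hq.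
split; rewrite ?raE ?rbE ?rcE ?rdE.
- exact: (ybe_aa F0 S0 FN SN SS FF SF).
(* Writing the zero as the left-hand side of the abstract identity leaves only the derivative terms
   to be matched, one sum at a time. *)
- rewrite -[RHS](ybe_dd F0 FN SN SS FF SF).
  congr (_ + _ - _ + _); apply: eq_bigr => k _; congr (_ *m _).
  + exact: partial_leg23_rd.
  + exact: partial_leg13_rd.
  + exact: partial_leg12_rd.
- rewrite -[RHS](ybe_db F0 S0 FN SN SS FF SF).
  congr (_ + _ - _); apply: eq_bigr => k _; congr (_ *m _).
  + exact: partial_leg23_rb.
  + exact: partial_leg13_rb.
- rewrite -[RHS](ybe_ac F0 S0 FN SN SS FF SF).
  congr (_ - _); apply: eq_bigr => k _; congr (_ *m _).
  exact: partial_leg12_ra.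
Qed.
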